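(* Let $K$ be a field, $R=K[x_0,\dots,x_N]=K[\mathbf{P}^N]$ and $M=(x_0,\dots,x_N)$. Let $p_1,\dots,p_n\in\mathbf{P}^N$ be distinct points, let $J=\bigcap_i I(p_i)\subset R$, let $m\ge 1$, and let $I=J^{(m)}$. Let $r\ge 1$. If for some integer $s$ the ideal $J$ is generated by a set of homogeneous elements each having degree at most $s$, and if $\alpha(I^{(Nr)})\ge rms+rm(N-1)$, then $I^{(Nr)}\subseteq M^{r(N-1)}I^r$.
   Context: For a point $p\in\mathbf{P}^N$ (a $K$-rational point), $I(p)\subset R$ is the ideal generated by all forms vanishing at $p$. For $J=\bigcap_i I(p_i)$ with distinct $p_i$, the $m$-th symbolic power is $J^{(m)}=\bigcap_i I(p_i)^m$, and for $I=J^{(m)}$ one has $I^{(k)}=J^{(mk)}=\bigcap_i I(p_i)^{mk}$. For a nonzero homogeneous ideal $J$, $\alpha(J)$ is the smallest integer $l$ such that the degree-$l$ component $J_l$ is nonzero. *)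

(* Defs.v *)
From HB Require Import structures.
From mathcomp Require Import all_boot all_order all_algebra.
From mathcomp Require Import mpoly.
From mathcomp Require Import boolp classical_sets.

Set Implicit Arguments.
Unset Strict Implicit.
Unset Printing Implicit Defensive.

Import Order.TTheory GRing.Theory Num.Theory.
Local Open Scope classical_set_scope.
Local Open Scope ring_scope.

Section Ideals.
Variable A : comNzRingType.
Implicit Types (G I J : set A).

Definition ideal_gen G : set A :=
  [set x | exists (k : nat) (a g : 'I_k -> A),
     (forall i, G (g i)) /\ x = \sum_(i < k) a i * g i].

Definition ideal_mul I J : set A :=
  ideal_gen [set x | exists a b, [/\ I a, J b & x = a * b]].

Definition ideal_exp I (k : nat) : set A := iter k (ideal_mul I) setT.

End Ideals.

(* A K-rational point of P^N is a line through the origin of K^(N+1), so that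
   equality of points is Leibniz equality. *)
Record proj_point (K : fieldType) (N : nat) := ProjPoint {
  proj_line :> {vspace 'rV[K]_N.+1};
  _ : \dim proj_line == 1%N
}.

HB.instance Definition _ K N := [isSub for @proj_line K N].
HB.instance Definition _ K N := [Equality of proj_point K N by <:].

Section Points.
Variables (K : fieldType) (N : nat).
Notation R := {mpoly K[N.+1]}.

Definition is_form (d : nat) (f : R) : Prop := f \is d.-homog.

(* f vanishes at every choice of homogeneous coordinates of q; including the
   zero vector of the line changes nothing when f is a form. *)
Definition vanishes_at (f : R) (q : proj_point K N) : Prop :=
  forall v : 'rV[K]_N.+1, v \in proj_line q -> f.@[v ord0] = 0.

Definition point_ideal (q : proj_point K N) : set R :=
  ideal_gen [set f | (exists d, is_form d f) /\ vanishes_at f q].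

Definition irrelevant_ideal : set R := ideal_gen [set 'X_i | i in setT].

Definition points_ideal n (p : 'I_n -> proj_point K N) : set R :=
  \bigcap_(i in setT) point_ideal (p i).

(* J^(m) for J = points_ideal p. If I = J^(m), then I^(k) = J^(m * k). *)
Definition symbolic_power n (p : 'I_n -> proj_point K N) (m : nat) : set R :=
  \bigcap_(i in setT) ideal_exp (point_ideal (p i)) m.

Definition nonzero_component (J : set R) (l : nat) : Prop :=
  exists f, [/\ J f, is_form l f & f != 0].

(* The value at the zero ideal is the junk value 0. *)
Definition alpha (J : set R) : nat :=
  xget 0%N [set l | nonzero_component J l /\
                    forall l', nonzero_component J l' -> (l <= l')%N].

Definition generated_in_degree_le (J : set R) (s : int) : Prop :=
  exists G : set R,
    (forall g, G g -> exists d : nat, is_form d g /\ d%:Z <= s) /\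
    J = ideal_gen G.

End Points.

Arguments irrelevant_ideal : clear implicits.

(* Main.v *)
(* The key point is J^(Nk) <= J^k for k = m r; the rest is a degree count, since J^k
   is generated in degree at most k s.

   Each ideal P_i of a point is generated by N linear forms, so by the pigeonhole
   principle P_i^(NQ) lies in the Frobenius power P_i^[Q].  Over a perfect field of
   characteristic p, this gives J^(Nk) <= J^k by the argument of Hochster and Huneke.
   Over an arbitrary field, a form f of J^(Nk) outside J^k is a counterexample that
   can be described by finitely many equations over a finitely generated subring of K.
   Such a subring maps to the algebraic closure of a prime field F_p, which yields a
   counterexample there. *)
Require Import Defs.
From mathcomp Require Import all_boot all_order all_algebra all_field.
From mathcomp Require Import mpoly.
From mathcomp Require Import boolp classical_sets.
From mathcomp Require Import zify ring.

Set Implicit Arguments.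
Unset Strict Implicit.
Unset Printing Implicit Defensive.

Import Order.TTheory GRing.Theory Num.Theory.
Local Open Scope classical_set_scope.
Local Open Scope ring_scope.

(** Lying outside J^k is not an equation. Moreover, specializing coordinates can make two points
    collide, or lower the rank of the conditions that define J and so enlarge J. Three devices
    answer this. A linear functional on forms of degree t that kills J^k and takes the value 1 on f
    turns non-membership into equations. A matrix Z with E Z E = E, where E evaluates homogeneous
    components at the points, gives explicit elements of J whose specializations still generate the
    ideal of the specialized points up to degree t. Finally, the statement in positive
    characteristic is proved for any finite family of ideals with N generators each, so collisions
    are harmless. The target field is algebraically closed because perfectness is required: Q-th
    roots of coefficients define the Cartier operators. *)

Section Ideals.
Variable A : comNzRingType.
Implicit Types (G I J S : set A).

Definition is_ideal S : Prop :=
  [/\ S 0, (forall x y, S x -> S y -> S (x + y)) & (forall a x, S x -> S (a * x))].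

Lemma ideal_sum S (T : Type) (s : seq T) (P : pred T) (F : T -> A) :
  is_ideal S -> (forall i, P i -> S (F i)) -> S (\sum_(i <- s | P i) F i).
Proof. by case=> S0 SD _ SF; elim/big_ind: _. Qed.

Lemma ideal_genI G : is_ideal (ideal_gen G).
Proof.
split.
- by exists 0%N, (fun=> 0), (fun=> 0); split=> [[]|] //; rewrite big_ord0.
- move=> _ _ [k [a [g [Gg ->]]]] [l [b [h [Gh ->]]]].
  exists (k + l)%N, (fun i => match split i with inl i => a i | inr i => b i end),
    (fun i => match split i with inl i => g i | inr i => h i end).
  split=> [i|]; first by case: (split i).
  rewrite big_split_ord /=; congr (_ + _); apply: eq_bigr => i _.
    by rewrite (unsplitK (inl i)).
  by rewrite (unsplitK (inr i)).
- move=> c _ [k [a [g [Gg ->]]]].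
  exists k, (fun i => c * a i), g; split=> //.
  by rewrite mulr_sumr; apply: eq_bigr => i _; rewrite mulrA.
Qed.

Lemma sub_ideal_gen G : G `<=` ideal_gen G.
Proof.
by move=> x Gx; exists 1%N, (fun=> 1), (fun=> x); rewrite big_ord1 mul1r.
Qed.

Lemma ideal_gen_min G S : is_ideal S -> G `<=` S -> ideal_gen G `<=` S.
Proof.
move=> SI GS _ [k [a [g [Gg ->]]]]; apply: (ideal_sum _ SI) => i _.
by case: SI => _ _ SM; apply/SM/GS.
Qed.

Lemma ideal_genS G H : G `<=` H -> ideal_gen G `<=` ideal_gen H.
Proof.
by move=> GH; apply: (ideal_gen_min (ideal_genI _)) => x /GH; apply: sub_ideal_gen.
Qed.

Lemma ideal_gen_id S : is_ideal S -> ideal_gen S = S.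
Proof.
by move=> SI; apply/seteqP; split; [apply: ideal_gen_min | apply: sub_ideal_gen].
Qed.

Lemma bigcap_ideal n (F : 'I_n -> set A) :
  (forall i, is_ideal (F i)) -> is_ideal (\bigcap_(i in setT) F i).
Proof.
move=> FI; split=> [i _|x y Fx Fy i _|a x Fx i _]; case: (FI i) => F0 FD FM //.
- by apply: FD; [apply: Fx | apply: Fy].
- by apply: FM; apply: Fx.
Qed.

Lemma ideal_mul_mem I J x y : I x -> J y -> ideal_mul I J (x * y).
Proof. by move=> Ix Jy; apply: sub_ideal_gen; exists x, y. Qed.

Lemma ideal_mul_min I J S : is_ideal S ->
  (forall x y, I x -> J y -> S (x * y)) -> ideal_mul I J `<=` S.
Proof.
by move=> SI H; apply: (ideal_gen_min SI) => _ [x [y [Ix Jy ->]]]; apply: H.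
Qed.

Lemma ideal_expI I k : is_ideal (ideal_exp I k).
Proof. by case: k => [|k]; [split | apply: ideal_genI]. Qed.

Lemma ideal_expS I k : ideal_exp I k.+1 = ideal_mul I (ideal_exp I k).
Proof. by []. Qed.

Lemma ideal_exp_prod I k (g : 'I_k -> A) :
  (forall i, I (g i)) -> ideal_exp I k (\prod_(i < k) g i).
Proof.
elim: k g => [//|k IHk] g Ig; rewrite big_ord_recl ideal_expS.
by apply: ideal_mul_mem => //; apply: IHk => i.
Qed.

Definition prods G k : set A :=
  [set x | exists g : 'I_k -> A, (forall i, G (g i)) /\ x = \prod_(i < k) g i].

(** Reduces membership in a power to a single product of generators; the pigeonhole argument, the
    homogeneity of powers and the final degree count all work on such a product. *)
Lemma ideal_exp_gen G k : ideal_exp (ideal_gen G) k = ideal_gen (prods G k).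
Proof.
apply/seteqP; split; last first.
  apply: (ideal_gen_min (ideal_expI _ _)) => _ [g [Gg ->]].
  by apply: ideal_exp_prod => i; apply/sub_ideal_gen/Gg.
elim: k => [|k IHk].
  move=> x _; rewrite -[x]mulr1; case: (ideal_genI (prods G 0)) => _ _; apply.
  by apply: sub_ideal_gen; exists (fun=> 1); split; [case | rewrite big_ord0].
apply: (ideal_mul_min (ideal_genI _)) => _ y [l [a [g [Gg ->]]]] /IHk [l' [b [h [Gh ->]]]].
rewrite mulr_suml; apply: (ideal_sum _ (ideal_genI _)) => i _.
rewrite mulr_sumr; apply: (ideal_sum _ (ideal_genI _)) => j _.
rewrite mulrACA; case: (ideal_genI (prods G k.+1)) => _ _; apply.
apply: sub_ideal_gen; have [g' [Gg' ->]] := Gh j.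
exists (fun u => if unlift ord0 u is Some v then g' v else g i).
split=> [u|]; first by case: unliftP.
by rewrite big_ord_recl unlift_none; congr (_ * _); apply: eq_bigr => u _; rewrite liftK.
Qed.

Lemma ideal_exp_sub I J k : I `<=` J -> ideal_exp I k `<=` ideal_exp J k.
Proof.
move=> IJ; elim: k => [//|k IHk]; rewrite !ideal_expS; apply: ideal_genS.
by move=> _ [x [y [/IJ Jx /IHk Jy ->]]]; exists x, y.
Qed.

Lemma ideal_exp_mul I j k x y :
  ideal_exp I j x -> ideal_exp I k y -> ideal_exp I (j + k) (x * y).
Proof.
move=> + Iy; elim: j x => [x _|j IHj x].
  by case: (ideal_expI I k) => _ _; apply.
rewrite addSn !ideal_expS.
(* For fixed [y], the elements whose product with [y] lies in the target form a colon ideal, so only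
   products [u * v] have to be checked. *)
suff: ideal_mul I (ideal_exp I j) `<=`
    [set x | ideal_mul I (ideal_exp I (j + k)) (x * y)] by apply.
case: (ideal_genI [set x | exists a b, [/\ I a, ideal_exp I (j + k) b & x = a * b]])
  => S0 SD SM.
apply: ideal_mul_min => [|u v Iu Iv /=]; last first.
  by rewrite -mulrA; apply: ideal_mul_mem => //; apply: IHj.
split=> [|u v Su Sv|a u Su] /=; first by rewrite mul0r.
- by rewrite mulrDl; apply: SD.
- by rewrite -mulrA; apply: SM.
Qed.

Lemma ideal_exp_leq I j k : (j <= k)%N -> ideal_exp I k `<=` ideal_exp I j.
Proof.
move=> /subnK <-; elim: (k - j)%N => [//|l IHl].
rewrite addSn ideal_expS; apply: (ideal_mul_min (ideal_expI _ _)) => x y _ /IHl Iy.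
by case: (ideal_expI I j) => _ _; apply.
Qed.

Lemma ideal_exp_pow I j k x : ideal_exp I j x -> ideal_exp I (j * k) (x ^+ k).
Proof.
move=> Ix; elim: k => [|k IHk]; first by rewrite muln0.
by rewrite mulnS exprS; apply: ideal_exp_mul.
Qed.

Lemma ideal_exp_exp I j k : is_ideal I -> ideal_exp I (j * k) `<=` ideal_exp (ideal_exp I j) k.
Proof.
move=> II; elim: k => [//|k IHk]; rewrite mulnS ideal_expS.
rewrite -[in X in X `<=` _](ideal_gen_id II) ideal_exp_gen.
apply: (ideal_gen_min (ideal_genI _)) => _ [g [Ig ->]].
rewrite big_split_ord /=; apply: ideal_mul_mem; first exact: ideal_exp_prod.
by apply/IHk/ideal_exp_prod.
Qed.

End Ideals.

(** * Cartier operators, and the containment over a perfect field of characteristic p *)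

Section Cartier.
Variables (F : fieldType) (n Q : nat) (rt : F -> F).
Hypothesis Qchar : [pchar F].-nat Q.
Hypothesis rtK : forall x, rt x ^+ Q = x.
Notation R := {mpoly F[n]}.
Implicit Types (u m k : 'X_{1..n}) (c d f : R).

Let Q_gt0 : (0 < Q)%N. Proof. by case/andP: Qchar. Qed.

Let QcharR : [pchar R].-nat Q.
Proof. by rewrite (eq_pnat _ (pchar_lalg R)). Qed.

(** In characteristic p a Q-th root is unique, so the chosen root function [rt] is automatically a
    ring morphism. *)
Lemma rt_inj (x y : F) : x ^+ Q = y ^+ Q -> x = y.
Proof.
move=> xy; apply/eqP; rewrite -subr_eq0; have /eqP : (x - y) ^+ Q = 0.
  by rewrite exprDn_pchar // exprNn_pchar // xy subrr.
by rewrite expf_eq0 => /andP[].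
Qed.

Lemma rtD (x y : F) : rt (x + y) = rt x + rt y.
Proof. by apply: rt_inj; rewrite exprDn_pchar // !rtK. Qed.

Lemma rtM (x y : F) : rt (x * y) = rt x * rt y.
Proof. by apply: rt_inj; rewrite exprMn !rtK. Qed.

Lemma rtX (x : F) : rt (x ^+ Q) = x.
Proof. by apply: rt_inj; rewrite rtK. Qed.

Lemma rt0 : rt 0 = 0.
Proof. by apply: rt_inj; rewrite rtK expr0n; case: Q Q_gt0. Qed.

Lemma rt1 : rt 1 = 1.
Proof. by apply: rt_inj; rewrite rtK expr1n. Qed.

(** For [u] with entries below [Q], this is the Q-th root of the coefficient of ['X_[u]] when [c] is
    expanded over the subring of Q-th powers. *)
Definition cartier u c : R :=
  \sum_(m : 'X_{1..n < msize c}) rt c@_(u + m *+ Q) *: 'X_[m].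

Lemma cartierE u c m : (cartier u c)@_m = rt c@_(u + m *+ Q).
Proof.
rewrite /cartier; have [lt_m|le_m] := ltnP (mdeg m) (msize c).
  by rewrite (mcoeff_mpoly (fun m => rt c@_(u + m *+ Q))).
rewrite (@memN_msupp_eq0 _ _ c) ?rt0; last first.
  apply: msize_mdeg_ge; rewrite mdegD mdegMn.
  by rewrite (leq_trans le_m) // (leq_trans _ (leq_addl _ _)) // leq_pmulr.
rewrite raddf_sum big1 // => k _ /=; rewrite mcoeffZ mcoeffX.
case: eqP => [km|]; last by rewrite mulr0.
by have := bmdeg k; rewrite km ltnNge le_m.
Qed.

Lemma cartierD u c d : cartier u (c + d) = cartier u c + cartier u d.
Proof. by apply/mpolyP => m; rewrite mcoeffD !cartierE mcoeffD rtD. Qed.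

Lemma cartier0 u : cartier u 0 = 0.
Proof. by apply/mpolyP => m; rewrite cartierE !mcoeff0 rt0. Qed.

Lemma cartier_sum u (T : Type) (s : seq T) (G : T -> R) :
  cartier u (\sum_(i <- s) G i) = \sum_(i <- s) cartier u (G i).
Proof. by elim/big_rec2: _ => [|i _ c _ <-]; rewrite ?cartier0 ?cartierD. Qed.

Lemma mcoeffMX_eq0 c m k : ~~ (m <= k)%MM -> (c * 'X_[m])@_k = 0.
Proof.
move=> mk; apply: memN_msupp_eq0; rewrite (perm_mem (msuppMX _ _)).
by apply: contra mk => /mapP[k' _ ->]; rewrite lem_addr.
Qed.

(** On a monomial [a = 'X_[m]] both sides shift exponents by [m]. The bound on [u] enters when [m]
    is not below [k]: since [u i < Q], an inequality [m i * Q <= u i + k i * Q] forces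
    [m i <= k i]. *)
Lemma cartierM u a c : (forall i, u i < Q)%N ->
  cartier u (a ^+ Q * c) = a * cartier u c.
Proof.
move=> uQ; elim/mpolyind: a => [|x m a _ _ IHa].
  by rewrite expr0n (gtn_eqF Q_gt0) !mul0r cartier0.
rewrite exprDn_pchar // !mulrDl cartierD IHa; congr (_ + _).
apply/mpolyP => k; rewrite cartierE exprZn mpolyXn -!scalerAl !mcoeffZ rtM rtX.
congr (_ * _); rewrite ![_ * c]mulrC ![_ * cartier _ _]mulrC.
have [mk|mk] := boolP (m <= k)%MM.
  rewrite -(submK mk) [X in (_ * 'X_[m])@_X]addmC mcoeffMX cartierE.
  rewrite (_ : u + _ *+ Q = m *+ Q + (u + (k - m) *+ Q))%MM ?mcoeffMX //.
  by apply/mnmP => i; rewrite !(mnmDE, mulmnE, mnmBE); lia.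
rewrite !mcoeffMX_eq0 ?rt0 //; apply: contra mk => /mnm_lepP mk.
apply/mnm_lepP => i; move: (mk i) (uQ i); rewrite mnmDE !mulmnE => mki ui.
rewrite leqNgt; apply/negP => lt_km.
have : ((k i).+1 * Q <= m i * Q)%N by rewrite leq_mul2r lt_km orbT.
rewrite mulSn; move: (k i * Q)%N (m i * Q)%N mki => A B; lia.
Qed.

Definition box (w : {ffun 'I_n -> 'I_Q}) : 'X_{1..n} := [multinom w i : nat | i < n].

Lemma box_lt w i : (box w i < Q)%N.
Proof. by rewrite mnmE ltn_ord. Qed.

Lemma cartier_box w w' : cartier (box w) 'X_[box w'] = (w == w')%:R.
Proof.
apply/mpolyP => k; rewrite cartierE mcoeffX.
have -> : (box w' == box w + k *+ Q)%MM = (w == w') && (k == 0%MM).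
  apply/eqP/andP => [E|[/eqP-> /eqP->]]; last first.
    by apply/mnmP => i; rewrite mnmDE mulmnE mnm0E addn0.
  have H i : w i = w' i /\ k i = 0%N.
    move/mnmP/(_ i): E; rewrite mnmDE mulmnE !mnmE => E.
    have k0 : k i = 0%N.
      case: (k i) E => // l; rewrite mulSn => E.
      have := ltn_ord (w' i); rewrite E; move: (l * Q)%N; lia.
    by split=> //; apply: val_inj; rewrite /= E k0 addn0.
  by split; [apply/eqP/ffunP => i | apply/eqP/mnmP => i; rewrite ?mnm0E];
    case: (H i).
case: eqP => _ /=; last by rewrite mcoeff0 rt0.
by rewrite mcoeff1 eq_sym; case: eqP; rewrite ?rt1 ?rt0.
Qed.

(** The box monomials form a basis over the Q-th powers, by Euclidean division of exponents by [Q].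
    Hence an element whose Cartier images all lie in J lies in the Frobenius power J^[Q]. *)
Lemma cartier_decomp c :
  c = \sum_(w : {ffun 'I_n -> 'I_Q}) cartier (box w) c ^+ Q * 'X_[box w].
Proof.
elim/mpolyind: c => [|x m c _ _ IHc].
  by rewrite big1 // => w _; rewrite cartier0 expr0n (gtn_eqF Q_gt0) mul0r.
under eq_bigr do rewrite cartierD exprDn_pchar // mulrDl.
rewrite big_split /= -IHc; congr (_ + _).
pose w0 := [ffun i => Ordinal (ltn_pmod (m i) Q_gt0)] : {ffun 'I_n -> 'I_Q}.
pose k0 := [multinom (m i %/ Q)%N | i < n].
have -> : x *: 'X_[m] = (rt x *: 'X_[k0]) ^+ Q * 'X_[box w0].
  rewrite exprZn rtK -scalerAl mpolyXn -mpolyXD; congr (_ *: 'X_[_]).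
  by apply/mnmP => i; rewrite mnmDE mulmnE !mnmE ffunE /= -divn_eq.
have cartier_w0 w : cartier (box w) ((rt x *: 'X_[k0]) ^+ Q * 'X_[box w0]) =
    (rt x *: 'X_[k0]) * (w == w0)%:R.
  by rewrite cartierM ?cartier_box // => i; apply: box_lt.
under eq_bigr do rewrite cartier_w0.
rewrite (bigD1 w0) //= eqxx mulr1 big1 ?addr0 // => w /negPf->.
by rewrite mulr0 expr0n (gtn_eqF Q_gt0) mul0r.
Qed.

(** Take [u] to be the leading exponent: every other exponent [u + m *+ Q] has degree at least [Q],
    beyond the support of [c]. *)
Lemma cartier_small c : (msize c <= Q)%N -> c != 0 ->
  exists2 u : 'X_{1..n}, (forall i, u i < Q)%N & exists2 x : F, x != 0 & cartier u c = x%:MP.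
Proof.
move=> cQ c0; have := mlead_supp c0; set u := mlead c => u_c.
exists u => [i|].
  apply: leq_trans cQ; apply: leq_trans (msize_mdeg_lt u_c).
  by rewrite ltnS mdegE (bigD1 i) //= leq_addr.
exists (rt c@_u).
  apply/eqP => E; move: u_c; rewrite mcoeff_msupp => /eqP; apply.
  by rewrite -[LHS]rtK E expr0n (gtn_eqF Q_gt0).
apply/mpolyP => k; rewrite cartierE mcoeffC.
have [->|k0] := eqVneq k 0%MM.
  by rewrite mulr1; congr (rt c@_ _); apply/mnmP => i; rewrite mnmDE mulmnE mnm0E addn0.
rewrite mulr0 memN_msupp_eq0 ?rt0 //; apply: msize_mdeg_ge.
rewrite mdegD mdegMn (leq_trans cQ) // (leq_trans _ (leq_addl _ _)) //.
by rewrite leq_pmull // lt0n mdeg_eq0.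
Qed.

Lemma pigeonhole_prod N (G : 'I_N -> R) (w : 'I_(N * Q) -> 'I_N) : (0 < N)%N ->
  exists i b, \prod_(j < N * Q) G (w j) = G i ^+ Q * b.
Proof.
move=> N_gt0.
have [i Hi] : exists i, (Q <= #|[pred j | w j == i]|)%N.
  apply/not_existsP => H.
  have := card_ord (N * Q); rewrite -sum1_card.
  rewrite (partition_big w predT) //= => E.
  have: (\sum_(i < N) \sum_(j < N * Q | w j == i) 1 <= \sum_(i < N) Q.-1)%N.
    apply: leq_sum => i _; rewrite sum1_card -ltnS (ltn_predK Q_gt0) ltnNge.
    exact/negP/H.
  rewrite E sum_nat_const card_ord leq_mul2l (gtn_eqF N_gt0) /=.
  by rewrite -ltnS (ltn_predK Q_gt0) ltnn.
exists i, (G i ^+ (#|[pred j | w j == i]| - Q) * \prod_(j < N * Q | w j != i) G (w j)).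
rewrite (bigID (fun j => w j == i)) /= mulrA -exprD subnKC //; congr (_ * _).
by rewrite -prodr_const; apply: eq_bigr => j /eqP->.
Qed.

Lemma cartier_exp u N (G : 'I_N -> R) c : (0 < N)%N -> (forall i, u i < Q)%N ->
  ideal_exp (ideal_gen (range G)) (N * Q) c -> ideal_gen (range G) (cartier u c).
Proof.
move=> N_gt0 uQ; rewrite ideal_exp_gen => -[l [a [g [Gg ->]]]].
rewrite cartier_sum; apply: (ideal_sum _ (ideal_genI _)) => i _.
have [h [Hh ->]] := Gg i.
have /choice [w Hw] : forall j, exists v, G v = h j.
  by move=> j; have [v _ <-] := Hh j; exists v.
under eq_bigr do rewrite -Hw.
have [v [b ->]] := pigeonhole_prod G w N_gt0.
rewrite mulrCA cartierM // mulrC.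
by case: (ideal_genI (range G)) => _ _; apply; apply: sub_ideal_gen; exists v.
Qed.

End Cartier.

(* The tight closure argument of Hochster and Huneke, with the flatness of
   Frobenius replaced by the operators [cartier u]: writing Q = a k + b for a
   large power Q of p, h f^a lies in every P_i^[Q], hence in J^[Q], so that
   h^k f^Q lies in (J^k)^[Q], and then f * cartier u (h^k) lies in J^k. *)
Lemma perfect_containment (F : fieldType) (p N n s k : nat)
    (G : 'I_s -> 'I_N -> {mpoly F[n]}) (h f : {mpoly F[n]}) :
  p \in [pchar F] -> (forall x : F, exists y, y ^+ p = x) ->
  (0 < N)%N -> (0 < k)%N ->
  let J := \bigcap_(i in setT) ideal_gen (range (G i)) in
  h != 0 -> J h ->
  (forall i, ideal_exp (ideal_gen (range (G i))) (N * k) f) ->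
  ideal_exp J k f.
Proof.
move=> pF perf N_gt0 k_gt0 J h_neq0 Jh fP.
have JI : is_ideal J by apply: bigcap_ideal => i; apply: ideal_genI.
have p_pr := pcharf_prime pF.
(* [c] is fixed before [Q], so that [Q] can be chosen beyond its degree; some [cartier u c] is then
   a nonzero scalar. *)
pose c := (h ^+ (N * k)) ^+ k.
have c_neq0 : c != 0 by rewrite !expf_neq0.
pose e := msize c; pose Q := (p ^ e)%N.
have cQ : (msize c <= Q)%N by rewrite ltnW // ltn_expl // prime_gt1.
have Qchar : [pchar F].-nat Q.
  by rewrite (eq_pnat _ (pcharf_eq pF)) pnatX pnat_id.
have perfQ : forall x : F, exists y, y ^+ Q = x.
  rewrite /Q; elim: e {cQ Q Qchar} => [|e IHe] x; first by exists x; rewrite expr1.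
  have [y <-] := perf x; have [z <-] := IHe y.
  by exists z; rewrite expnSr exprM.
have [rt rtK] := choice perfQ.
have [u uQ [x x_neq0 Ex]] := cartier_small Qchar rtK cQ c_neq0.
pose a := (Q %/ k)%N; pose b := (Q %% k)%N.
have EQ : (Q = a * k + b)%N by apply: divn_eq.
(* The factor [h ^+ (N * k)] makes up for the remainder [b < k]: the total order N k + N k a is at
   least N (a k + b) = N Q. *)
pose y := h ^+ (N * k) * f ^+ a.
have Jy (v : 'X_{1..n}) : (forall i, v i < Q)%N -> J (cartier Q rt v y).
  move=> vQ i _; apply: (cartier_exp Qchar rtK N_gt0 vQ).
  apply: (@ideal_exp_leq _ _ _ (1 * (N * k) + (N * k) * a)).
    rewrite mul1n -mulnA -mulnDr leq_mul2l -mulnS [(k * _)%N]mulnC mulSn EQ.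
    by rewrite addnC leq_add2r ltnW ?orbT // ltn_mod.
  apply: ideal_exp_mul; last exact: ideal_exp_pow.
  apply: ideal_exp_pow; rewrite ideal_expS -[h]mulr1.
  by apply: ideal_mul_mem => //; apply: Jh.
have JQ : ideal_exp (ideal_gen [set z ^+ Q | z in J]) k (y ^+ k).
  rewrite -[k in ideal_exp _ k]mul1n; apply: ideal_exp_pow.
  rewrite ideal_expS -[y]mulr1; apply: ideal_mul_mem => //.
  rewrite (cartier_decomp Qchar rtK y); apply: (ideal_sum _ (ideal_genI _)) => w _.
  rewrite mulrC; case: (ideal_genI [set z ^+ Q | z in J]) => _ _; apply.
  by apply: sub_ideal_gen; eexists; [apply: Jy; apply: box_lt | reflexivity].
have Jk : ideal_exp J k (cartier Q rt u (y ^+ k * f ^+ b)).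
  move: JQ; rewrite ideal_exp_gen => -[l [d [g [Hg ->]]]].
  rewrite mulr_suml (cartier_sum Qchar rtK); apply: (ideal_sum _ (ideal_expI _ _)) => i _.
  have [g' [Hg' ->]] := Hg i.
  have /choice [z Hz] : forall j, exists z, J z /\ z ^+ Q = g' j.
    by move=> j; have [z Jz <-] := Hg' j; exists z.
  have -> : \prod_(j < k) g' j = (\prod_(j < k) z j) ^+ Q.
    by rewrite -prodrXl; apply: eq_bigr => j _; case: (Hz j).
  rewrite [d i * _]mulrC -mulrA cartierM //; case: (ideal_expI J k) => _ _ JM.
  by rewrite mulrC; apply/JM/ideal_exp_prod => j; case: (Hz j).
suff E : y ^+ k * f ^+ b = f ^+ Q * c.
  move: Jk; rewrite E cartierM // Ex => Jk.
  have -> : f = (x^-1)%:MP * (f * x%:MP).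
    by rewrite mulrCA -mpolyCM mulVf // mulr1.
  by case: (ideal_expI J k) => _ _; apply.
rewrite /y /c exprMn -exprM -mulrA -[_ ^+ a ^+ k]exprM -exprD -EQ.
by rewrite mulrC.
Qed.

(** * Homomorphisms from finitely generated subrings of a field to positive characteristic *)

Definition ev (A S : comNzRingType) (f : {rmorphism A -> S}) (x : S) :
    {rmorphism {poly A} -> S} :=
  horner_morph (fun a => mulrC x (f a)).

Lemma evE (A S : comNzRingType) (f : {rmorphism A -> S}) x P :
  ev f x P = (map_poly f P).[x].
Proof. by []. Qed.

Lemma evC (A S : comNzRingType) (f : {rmorphism A -> S}) x a : ev f x a%:P = f a.
Proof. exact: horner_morphC. Qed.

Lemma evZ (A S : comNzRingType) (f : {rmorphism A -> S}) x a P :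
  ev f x (a *: P) = f a * ev f x P.
Proof. by rewrite -mul_polyC rmorphM /= evC. Qed.

Lemma min_size (A : idomainType) (S : {poly A} -> Prop) (P0 : {poly A}) : S P0 ->
  exists2 P, S P & forall G, S G -> (size P <= size G)%N.
Proof.
move=> SP0; pose T := [pred n | `[< exists2 G, S G & size G = n >]].
have exT : exists n, T n by exists (size P0); apply/asboolP; exists P0.
case: (ex_minnP exT) => n /asboolP[P SP <-] minP; exists P => // G SG.
by apply: minP; apply/asboolP; exists G.
Qed.

Lemma drop_lead (A : idomainType) (P : {poly A}) : P != 0 ->
  exists2 G : {poly A}, (size G < size P)%N & P = G + lead_coef P *: 'X^((size P).-1).
Proof.
move=> P_neq0; exists (P - lead_coef P *: 'X^((size P).-1)); last by rewrite subrK.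
rewrite (polySpred P_neq0) ltnS; apply/leq_sizeP => j.
rewrite leq_eqVlt coefB coefZ coefXn => /orP[/eqP<-|lt_j].
  by rewrite eqxx mulr1 subrr.
by rewrite (gtn_eqF lt_j) mulr0 subr0 nth_default // (polySpred P_neq0).
Qed.

(* The extension step of Zariski's lemma (Atiyah-Macdonald, Prop. 5.23).  The
   subrings A[x] of K are presented as images of polynomial rings, so that
   [phi] is defined on the image of [iota] when it vanishes on ker iota. *)
Lemma extend_hom (A : idomainType) (K : fieldType) (iota : {rmorphism A -> K})
    (x : K) (b : {poly A}) : ev iota x b != 0 ->
  exists2 a, iota a != 0 & forall (L : closedFieldType) (phi : {rmorphism A -> L}),
    (forall z, iota z = 0 -> phi z = 0) -> phi a != 0 ->
    exists2 y, (forall P, ev iota x P = 0 -> ev phi y P = 0) & ev phi y b != 0.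
Proof.
move=> b_x; pose alg P := ev iota x P = 0 /\ map_poly iota P != 0.
(* In the transcendental case every polynomial vanishing at [x] has zero image under [iota], so any
   [y] off the roots of [b] works once one coefficient of [b] survives in [L]. *)
have [[P0 algP0]|noalg] := pselect (exists P, alg P); last first.
  have b_neq0 : map_poly iota b != 0.
    by apply: contraNneq b_x => b0; rewrite evE b0 horner0.
  pose i := (size (map_poly iota b)).-1; exists b`_i.
    by rewrite -coef_map /= -/(lead_coef _) lead_coef_eq0.
  move=> L phi ker_phi phi_bi.
  have /closed_nonrootP[y y_b] : map_poly phi b != 0.
    apply: contraNneq phi_bi => phi_b0.
    by rewrite -[phi _]coef_map phi_b0 coef0.
  exists y; last by rewrite evE.
  move=> P P_x; have P0 : map_poly iota P = 0.
    by apply/eqP/negPn/negP => P_neq0; apply: noalg; exists P.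
  rewrite evE (_ : map_poly phi P = 0) ?horner0 //; apply/polyP => j.
  by rewrite coef_map coef0 /=; apply: ker_phi; rewrite -coef_map P0 coef0.
have [P [P_x P_neq0] minP] := min_size algP0.
have small_alg G : ev iota x G = 0 -> (size G < size P)%N -> map_poly iota G = 0.
  move=> G_x lt_GP; apply/eqP/negPn/negP => G_neq0.
  by have := minP G (conj G_x G_neq0); rewrite leqNgt lt_GP.
have P_neq0' : P != 0 by apply: contraNneq P_neq0 => ->; rewrite rmorph0.
have lcP : iota (lead_coef P) != 0.
  apply/eqP => lcP; have [G lt_GP EP] := drop_lead P_neq0'.
  have EG : ev iota x G = ev iota x P by rewrite EP rmorphD /= evZ lcP mul0r addr0.
  move: P_neq0; rewrite EP rmorphD /= linearZ_LR /= lcP scale0r addr0.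
  by rewrite small_alg ?eqxx // EG.
(* A minimal polynomial whose value at [x] is a nonzero multiple of that of [b] turns out to be a
   constant [a']. This plays the part of a resultant of [P] and [b]. *)
pose S H := ev iota x H != 0 /\ exists V, ev iota x H = ev iota x V * ev iota x b.
have Sb : S b by split=> //; exists 1; rewrite rmorph1 mul1r.
have [H [H_x [V H_V]] minH] := min_size Sb.
have H_neq0 : H != 0 by apply: contraNneq H_x => ->; rewrite rmorph0.
have lcH : iota (lead_coef H) != 0.
  apply/eqP => lcH; have [G lt_GH EH] := drop_lead H_neq0.
  have EG : ev iota x G = ev iota x H by rewrite EH rmorphD /= evZ lcH mul0r addr0.
  have SG : S G by rewrite /S EG; split=> //; exists V.
  by have := minH G SG; rewrite leqNgt lt_GH.
have lt_HP : (size H < size P)%N.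
  have E := Pdiv.Idomain.divp_eq H P.
  have Er : ev iota x (H %% P) = iota (lead_coef P ^+ scalp H P) * ev iota x H.
    by rewrite -evZ E rmorphD rmorphM /= P_x mulr0 add0r.
  have Sr : S (H %% P).
    rewrite /S Er; split; first by rewrite mulf_neq0 // rmorphXn expf_neq0.
    by exists (lead_coef P ^+ scalp H P *: V); rewrite evZ H_V mulrA.
  by apply: leq_ltn_trans (minH _ Sr) _; rewrite ltn_modp.
(* Pseudo-divide [P] by [H]. The remainder vanishes at [x], else it would be a smaller element of
   [S]; hence so does the quotient, whose size is then at least that of [P]. *)
have szH : (size H <= 1)%N.
  pose d := lead_coef H ^+ scalp P H; pose q : {poly A} := P %/ H.
  pose r : {poly A} := P %% H.
  have E : d *: P = q * H + r by apply: Pdiv.Idomain.divp_eq.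
  have d_neq0 : iota d != 0 by rewrite rmorphXn expf_neq0.
  have lt_rH : (size r < size H)%N by rewrite ltn_modp.
  have Eev : ev iota x q * ev iota x H + ev iota x r = 0.
    by rewrite -rmorphM -rmorphD -E /= evZ P_x mulr0.
  have r_x : ev iota x r = 0.
    apply/eqP/negPn/negP => r_x; have Sr : S r.
      split=> //; exists (- q * V); rewrite rmorphM rmorphN /= -mulrA -H_V mulNr.
      by apply/eqP; rewrite -addr_eq0 addrC Eev.
    by have := minH r Sr; rewrite leqNgt lt_rH.
  have r0 : map_poly iota r = 0 by apply: small_alg => //; apply: ltn_trans lt_HP.
  have q_x : ev iota x q = 0.
    by move/eqP: Eev; rewrite r_x addr0 mulf_eq0 (negPf H_x) orbF => /eqP.
  have q_neq0 : map_poly iota q != 0.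
    apply/eqP => q0; have : map_poly iota (d *: P) = 0.
      by rewrite E rmorphD rmorphM /= q0 r0 mul0r addr0.
    by rewrite linearZ_LR /= => /eqP; rewrite scaler_eq0 (negPf d_neq0) (negPf P_neq0).
  have q_neq0' : q != 0 by apply: contraNneq q_neq0 => ->; rewrite rmorph0.
  have le_Pq : (size P <= size q)%N by apply: minP.
  have : (size (q * H)%R <= size P)%N.
    have -> : q * H = d *: P - r by rewrite E addrK.
    rewrite (leq_trans (size_polyD _ _)) // size_polyN geq_max size_scale_leq /=.
    by rewrite ltnW // (ltn_trans lt_rH).
  rewrite size_mul //; move: H_neq0 le_Pq; rewrite -size_poly_gt0.
  by move: (size H) (size P) (size q) => sH sP sq; lia.
have [a' Ha'] : exists a', H = a'%:P by exists H`_0; apply: size1_polyC.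
(* The first factor preserves the degree of [P], so a root [y] exists and pseudo-division by [P] can
   be cancelled in [L]; the second gives [b] a nonzero value at [y], which divides [phi a']. *)
exists (lead_coef P * a').
  by rewrite rmorphM mulf_neq0 // -(evC iota x) -Ha'.
move=> L phi ker_phi; rewrite rmorphM mulf_eq0 negb_or => /andP[phi_lc phi_a'].
have /closed_rootP[y /rootP y_P] : size (map_poly phi P) != 1%N.
  have szE : size (map_poly phi P) = size P by apply: size_map_poly_id0.
  rewrite szE; apply/eqP => szP.
  have [a Ea] : exists a, P = a%:P by exists P`_0; apply: size1_polyC; rewrite szP.
  by move: P_x lcP; rewrite Ea evC lead_coefC => ->; rewrite eqxx.
have kill G : ev iota x G = 0 -> ev phi y G = 0.
  move=> G_x; have E := Pdiv.Idomain.divp_eq G P.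
  have r0 : map_poly iota (G %% P) = 0.
    apply: small_alg; last by rewrite ltn_modp.
    have : ev iota x (lead_coef P ^+ scalp G P *: G) = 0 by rewrite evZ G_x mulr0.
    by rewrite E rmorphD rmorphM /= P_x mulr0 add0r.
  have phi_r0 : map_poly phi (G %% P) = 0.
    apply/polyP => j; rewrite coef_map coef0 /=; apply: ker_phi.
    by rewrite -coef_map r0 coef0.
  have : ev phi y (lead_coef P ^+ scalp G P *: G) = 0.
    by rewrite E rmorphD rmorphM /= !evE y_P phi_r0 horner0 mulr0 addr0.
  rewrite evZ rmorphXn => /eqP; rewrite mulf_eq0 expf_eq0 (negPf phi_lc) andbF.
  by move/eqP.
exists y => //; have : ev phi y (H - V * b) = 0.
  by apply: kill; rewrite rmorphB rmorphM /= H_V subrr.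
rewrite rmorphB rmorphM /= Ha' evC => /eqP; rewrite subr_eq0 => /eqP E.
by apply: contraNneq phi_a' => b0; rewrite E b0 mulr0.
Qed.

(** Iterates [extend_hom] from the integers. [b] stays arbitrary because each adjunction asks an
    auxiliary element of the previous ring to survive; at the bottom this becomes one integer
    [c]. *)
Lemma extend_hom_seq (K : fieldType) (s : seq K) :
  exists (A : idomainType) (iota : {rmorphism A -> K}),
    (forall x, x \in s -> exists a, iota a = x) /\
    forall b, iota b != 0 -> exists2 c : int, c%:~R != 0 :> K &
      forall L : closedFieldType, (forall z : int, z%:~R = 0 :> K -> z%:~R = 0 :> L) ->
        c%:~R != 0 :> L ->
        exists2 phi : {rmorphism A -> L},
          (forall a, iota a = 0 -> phi a = 0) & phi b != 0.
Proof.
elim: s => [|x s [A [iota [lift_s hom_s]]]].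
  exists int, (intr : {rmorphism int -> K}); split=> // b b_neq0.
  by exists b => // L ker_L b_L; exists (intr : {rmorphism int -> L}).
exists {poly A}, (ev iota x); split=> [z|b b_x].
  rewrite inE => /orP[/eqP->|/lift_s[a <-]]; last by exists a%:P; rewrite evC.
  by exists 'X; rewrite evE map_polyX hornerX.
have [a a_neq0 ext_a] := extend_hom b_x.
have [c c_neq0 hom_c] := hom_s a a_neq0; exists c => // L ker_L c_L.
have [phi ker_phi phi_a] := hom_c L ker_L c_L.
by have [y ker_y y_b] := ext_a L phi ker_phi phi_a; exists (ev phi y).
Qed.

Lemma closed_field_pchar p : prime p ->
  exists L : closedFieldType, p \in [pchar L].
Proof.
move=> p_pr; have [L [f _]] := countable_algebraic_closure 'F_p.
by exists L; apply: (rmorph_pchar f); apply: pchar_Fp.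
Qed.

(** [L] must respect the integer relations of [K] and keep [c] nonzero: it gets the characteristic
    of [K] if that is positive, and otherwise a prime above [|c|]. *)
Lemma specialize (K : fieldType) (s : seq K) :
  exists (A : idomainType) (iota : {rmorphism A -> K}) (L : closedFieldType)
    (phi : {rmorphism A -> L}) (p : nat),
    [/\ p \in [pchar L], forall x, x \in s -> exists a, iota a = x &
        forall a, iota a = 0 -> phi a = 0].
Proof.
have [A [iota [lift_s hom_s]]] := extend_hom_seq s.
have [|c c_neq0 hom_c] := hom_s 1; first by rewrite rmorph1 oner_neq0.
have intr_pchar (M : fieldType) p (z : int) : p \in [pchar M] ->
    (z%:~R == 0 :> M) = (p %| `|z|)%N.
  move=> pM; case: (intP z) => [|n|n]; rewrite ?eqxx ?dvdn0 //.
    by rewrite -pmulrn (dvdn_pcharf pM).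
  by rewrite mulrNz oppr_eq0 -pmulrn abszN (dvdn_pcharf pM).
have [[p pK]|K0] := pselect (exists p, p \in [pchar K]).
  have [L pL] := closed_field_pchar (pcharf_prime pK).
  have [z /eqP||phi ker_phi _] := hom_c L.
  - by rewrite (intr_pchar K p) // -(intr_pchar L p) // => /eqP.
  - by rewrite (intr_pchar L p) // -(intr_pchar K p).
  by exists A, iota, L, phi, p.
have [p lt_cp p_pr] := prime_above `|c|.
have [L pL] := closed_field_pchar p_pr.
have int0 (z : int) : z%:~R = 0 :> K -> z = 0.
  move=> z0; apply/eqP/negPn/negP => z_neq0; apply: K0.
  have [] := @natf0_pchar K `|z|%N; rewrite ?absz_gt0 //; last by move=> q; exists q.
  by move/eqP: z0; case: (intP z) => [|n|n]; rewrite ?mulrNz ?oppr_eq0 ?abszN -?pmulrn.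
have [z /int0->||phi ker_phi _] := hom_c L; first by rewrite rmorph0.
  rewrite (intr_pchar L p) // gtnNdvd // absz_gt0.
  by apply: contraNneq c_neq0 => ->.
by exists A, iota, L, phi, p.
Qed.

(** * Homogeneous components and homogeneous ideals *)

Section Homogeneous.
Variables (S : comNzRingType) (n : nat).
Notation R := {mpoly S[n]}.
Implicit Types (f g h : R) (I : set R).
Local Notation pihomog := (pihomog mdeg).

Lemma mcoeff_pihomog d f m : (pihomog d f)@_m = if mdeg m == d then f@_m else 0.
Proof.
elim/mpolyind: f => [|c k f _ _ IHf]; first by rewrite pihomog0 !mcoeff0 if_same.
rewrite linearP /= !mcoeffD !mcoeffZ IHf pihomogX mcoeffX.
have [->|km] := eqVneq k m; first by case: ifP; rewrite ?mcoeffX ?mcoeff0 ?eqxx ?mulr0 ?addr0.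
case: ifP => _; rewrite ?mcoeffX ?(negPf km) ?mcoeff0 ?mulr0 ?add0r //.
Qed.

Lemma pihomogM d e f g : g \is e.-homog ->
  pihomog d (f * g) = if (e <= d)%N then pihomog (d - e) f * g else 0.
Proof.
move=> g_e; elim/mpolyind: f => [|c k f _ _ IHf].
  by rewrite mul0r !pihomog0 mul0r if_same.
rewrite mulrDl pihomogD IHf -scalerAl linearZ /= linearP /= mulrDl pihomogX.
have kg : 'X_[k] * g \is (mdeg k + e).-homog by rewrite dhomogM // dhomogX.
have [E|ne] := eqVneq (mdeg k + e)%N d.
  by rewrite -E leq_addl addnK eqxx pihomog_dE //= scalerAl.
rewrite (pihomog_ne0 ne) // scaler0 add0r; case: leqP => // le_ed.
by rewrite ifN ?scaler0 ?mul0r ?add0r //; apply: contraNneq ne => ->; rewrite subnK.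
Qed.

Lemma pihomog_sum_le f : f = \sum_(d < msize f) pihomog d f.
Proof. exact: pihomog_partitionE. Qed.

Definition homog_closed I : Prop := forall d f, I f -> I (pihomog d f).

Lemma ideal_gen_homog I : (forall g, I g -> exists d, g \is d.-homog) ->
  homog_closed (ideal_gen I).
Proof.
move=> Ihom d _ [k [a [g [Ig ->]]]]; rewrite linear_sum.
apply: (ideal_sum _ (ideal_genI _)) => i _; have [e g_e] := Ihom _ (Ig i).
rewrite /= (pihomogM _ _ g_e); case: (ideal_genI I) => I0 _ IM; case: ifP => // _.
exact/IM/sub_ideal_gen.
Qed.

Lemma homog_prod_ord k (g : 'I_k -> R) (e : 'I_k -> nat) :
  (forall i, g i \is (e i).-homog) -> \prod_(i < k) g i \is (\sum_(i < k) e i).-homog.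
Proof.
move=> g_e; elim/big_rec2: _ => [|i d h _ h_d]; first exact: dhomog1.
exact: dhomogM.
Qed.

(** A homogeneous ideal is generated by its forms, and a product of forms is a form. *)
Lemma ideal_exp_homog I k : is_ideal I -> homog_closed I -> homog_closed (ideal_exp I k).
Proof.
move=> II Ihom; pose G := [set g | I g /\ exists d, g \is d.-homog].
have -> : I = ideal_gen G.
  apply/seteqP; split; last by apply: (ideal_gen_min II) => g [].
  move=> f If; rewrite (pihomog_sum_le f); apply: (ideal_sum _ (ideal_genI _)) => d _.
  by apply: sub_ideal_gen; split; [apply: Ihom | exists d; apply: pihomogP].
rewrite ideal_exp_gen; apply: ideal_gen_homog => _ [g [Gg ->]].
have /choice[e g_e] : forall i, exists d, g i \is d.-homog by move=> i; case: (Gg i).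
by exists (\sum_(i < k) e i)%N; apply: homog_prod_ord.
Qed.

End Homogeneous.

(** * Linear algebra whose conclusions are equations *)

Lemma sum_enum_rank (V : nmodType) (T : finType) (H : 'I_#|T| -> V) :
  \sum_i H i = \sum_(x : T) H (enum_rank x).
Proof.
rewrite (reindex_onto enum_rank enum_val) /=; last by move=> i _; rewrite enum_valK.
by apply: eq_bigl => x; rewrite enum_rankK eqxx.
Qed.

(** The generalized inverse E Z E = E of a matrix over a field. *)
Lemma regular_inverse (F : fieldType) (I J : finType) (E : I -> J -> F) :
  exists Z : J -> I -> F, forall i j,
    \sum_i' (\sum_j' E i j' * Z j' i') * E i' j = E i j.
Proof.
pose M := \matrix_(i < #|I|, j < #|J|) E (enum_val i) (enum_val j).
exists (fun j i => pinvmx M (enum_rank j) (enum_rank i)) => i j.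
have /matrixP/(_ (enum_rank i) (enum_rank j)) := mulmxKpV (submx_refl M).
rewrite !mxE !enum_rankK sum_enum_rank => <-.
apply: eq_bigr => i' _; rewrite !mxE !enum_rankK sum_enum_rank; congr (_ * _).
by apply: eq_bigr => j' _; rewrite !mxE !enum_rankK.
Qed.

(** The functional is a rescaled column of the cokernel matrix on which [f] is nonzero. *)
Lemma separating_functional (F : fieldType) (I L : finType) (W : L -> I -> F) (f : I -> F) :
  (exists a : L -> F, forall i, f i = \sum_l a l * W l i) \/
  (exists2 lam : I -> F, forall l, \sum_i W l i * lam i = 0 & \sum_i f i * lam i = 1).
Proof.
pose M := \matrix_(l < #|L|, i < #|I|) W (enum_val l) (enum_val i).
pose u := \row_(i < #|I|) f (enum_val i).
have [/submxP[a Ea]|] := boolP (u <= M)%MS.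
  left; exists (fun l => a 0 (enum_rank l)) => i.
  have := congr1 (fun A : 'rV_#|I| => A 0 (enum_rank i)) Ea.
  rewrite !mxE enum_rankK sum_enum_rank => ->.
  by apply: eq_bigr => l _; rewrite mxE !enum_rankK.
rewrite submxE => /rV0Pn[j]; rewrite mxE => uj_neq0; right.
set x := \sum_j0 _ in uj_neq0.
exists (fun i => cokermx M (enum_rank i) j / x) => [l|].
  have := congr1 (fun A : 'M__ => A (enum_rank l) j) (mulmx_coker M).
  rewrite !mxE sum_enum_rank => /(congr1 ( *%R^~ x^-1)); rewrite mul0r mulr_suml.
  move=> E; apply: etrans E.
  by apply: eq_bigr => i _; rewrite [M _ _]mxE !enum_rankK mulrA.
apply: (mulIf uj_neq0); rewrite mul1r mulr_suml [RHS]sum_enum_rank.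
by apply: eq_bigr => i _; rewrite [u _ _]mxE enum_rankK -mulrA divfK.
Qed.

(** * Explicit linear generators for the ideal of a point *)

Section Lines.
Variable N : nat.

(** With the normalization [v c = 1], these are the equations of the line through [v]; no division
    occurs, so they make sense over any ring. *)
Definition line_gens (S : comNzRingType) (v : 'I_N.+1 -> S) (c : 'I_N.+1) (j : 'I_N) :
    {mpoly S[N.+1]} :=
  'X_(lift c j) - (v (lift c j))%:MP * 'X_c.

Lemma map_line_gens (S T : comNzRingType) (phi : {rmorphism S -> T}) v c j :
  map_mpoly phi (line_gens v c j) = line_gens (fun i => phi (v i)) c j.
Proof. by rewrite rmorphB rmorphM /= !map_mpolyX map_mpolyC. Qed.

Section Line.
Variables (S : comNzRingType) (v : 'I_N.+1 -> S) (c : 'I_N.+1).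
Hypothesis vc1 : v c = 1.
Notation P := (ideal_gen (range (line_gens v c))).
Notation R := {mpoly S[N.+1]}.

Lemma line_gens_homog j : line_gens v c j \is 1.-homog.
Proof.
apply: rpredB; first by rewrite dhomogX /= mdeg1.
by rewrite mul_mpolyC; apply: rpredZ; rewrite dhomogX /= mdeg1.
Qed.

Lemma line_gens_neq0 j : line_gens v c j != 0.
Proof.
apply/eqP => /(congr1 (mcoeff U_(lift c j))) /eqP.
rewrite mcoeff0 mcoeffB mul_mpolyC mcoeffZ !mcoeffXU eqxx.
by rewrite (negPf (neq_lift _ _)) mulr0 subr0 oner_eq0.
Qed.

Lemma line_ideal_homog : homog_closed P.
Proof. by apply: ideal_gen_homog => _ [j _ <-]; exists 1%N; apply: line_gens_homog. Qed.

Lemma line_congr_mul (x y z t : R) : P (x - y) -> P (z - t) -> P (x * z - y * t).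
Proof.
have [_ PD PM] := ideal_genI (range (line_gens v c)) => Pxy Pzt.
have -> : x * z - y * t = z * (x - y) + y * (z - t) by ring.
by apply: PD; apply: PM.
Qed.

(** Modulo the ideal, each variable ['X_i] is [v i] times ['X_c]. It follows that a form of degree d
    is congruent to its value at [v] times ['X_c ^+ d]. *)
Lemma line_congr_X m :
  P ('X_[m] - (\prod_i v i ^+ m i) *: 'X_c ^+ mdeg m).
Proof.
have [P0 PD PM] := ideal_genI (range (line_gens v c)).
have -> : (\prod_i v i ^+ m i) *: 'X_c ^+ mdeg m = \prod_i (v i *: 'X_c) ^+ m i :> R.
  under [RHS]eq_bigr do rewrite exprZn.
  by rewrite scaler_prod prodrXr -mdegE.
rewrite mpolyXE_id; elim/big_rec2: _ => [|i x y _ Pxy]; first by rewrite subrr.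
apply: line_congr_mul => //; elim: (m i) => [|e IHe]; first by rewrite !expr0 subrr.
rewrite !exprS; apply: line_congr_mul => //.
case: (unliftP c i) => [j ->|->]; last by rewrite vc1 scale1r subrr.
by rewrite -mul_mpolyC; apply: sub_ideal_gen; exists j.
Qed.

Lemma line_ideal_homogP d f : f \is d.-homog -> P f <-> f.@[v] = 0.
Proof.
have [P0 PD PM] := ideal_genI (range (line_gens v c)) => f_d; split.
  move=> [k [a [g [Pg ->]]]]; rewrite raddf_sum big1 // => i _ /=.
  have [j _ <-] := Pg i; rewrite mevalM mevalB mevalM mevalC !mevalXU vc1.
  by rewrite mulr1 subrr mulr0.
move=> fv0; suff: P (f - f.@[v] *: 'X_c ^+ d) by rewrite fv0 scale0r subr0.
rewrite mevalE scaler_suml [X in X - _]mpolyE -sumrB big_seq.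
apply: (ideal_sum _ (ideal_genI _)) => m m_f.
rewrite -scalerA -scalerBr -[_ *: (_ - _)]mul_mpolyC; apply: PM.
by rewrite -(dhomog_mf f_d m_f); apply: line_congr_X.
Qed.

Lemma line_idealP f : P f <-> forall d, (pihomog mdeg d f).@[v] = 0.
Proof.
split=> [Pf d|fv0].
  by apply/(line_ideal_homogP (pihomogP _ _ _))/line_ideal_homog.
rewrite (pihomog_sum_le f); apply: (ideal_sum _ (ideal_genI _)) => d _.
exact/(line_ideal_homogP (pihomogP _ _ _)).
Qed.

End Line.
End Lines.

(** * Generators of J up to degree t that survive specialization *)

Section Truncation.
Variables (S : comNzRingType) (N t : nat).
Notation R := {mpoly S[N.+1]}.
Notation B := 'X_{1..N.+1 < t.+1}.

(** The power t + 1 of the irrelevant ideal. J matters only modulo it, as the form under study has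
    degree t. *)
Definition order_gt : set R := [set h | forall m, (mdeg m <= t)%N -> h@_m = 0].

Lemma order_gtI : is_ideal order_gt.
Proof.
split=> [m _|x y xT yT m le_m|a x xT m le_m]; first by rewrite mcoeff0.
  by rewrite mcoeffD xT ?yT ?addr0.
rewrite mcoeffM big1 // => -[k1 k2] /= /eqP/(congr1 (@mdeg _)).
rewrite mdegD => E; rewrite xT ?mulr0 //; apply: leq_trans le_m.
by apply: leq_trans (leq_addl (mdeg k1) _) _; apply: eq_leq.
Qed.

Definition poly_of (w : B -> S) : R := \sum_(m : B) w m *: 'X_[m].

Lemma poly_ofE w (m : B) : (poly_of w)@_m = w m.
Proof.
rewrite raddf_sum (bigD1 m) //= mcoeffZ mcoeffX eqxx mulr1 big1 ?addr0 // => k km.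
by rewrite mcoeffZ mcoeffX -bmeqP (negPf km) mulr0.
Qed.

Lemma sub_poly_of h : order_gt (h - poly_of (fun m => h@_m)).
Proof.
move=> m; rewrite -ltnS => lt_m; rewrite mcoeffB.
by rewrite -[m]/(val (BMultinom lt_m)) poly_ofE subrr.
Qed.

Definition functional (lam : B -> S) (h : R) : S :=
  \sum_(m : B | mdeg m == t) h@_m * lam m.

Lemma functionalD lam h g : functional lam (h + g) = functional lam h + functional lam g.
Proof. by rewrite -big_split; apply: eq_bigr => m _; rewrite mcoeffD mulrDl. Qed.

Lemma functionalZ lam a h : functional lam (a *: h) = a * functional lam h.
Proof. by rewrite mulr_sumr; apply: eq_bigr => m _; rewrite mcoeffZ mulrA. Qed.

Lemma functional_order_gt lam h : order_gt h -> functional lam h = 0.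
Proof.
by move=> hT; rewrite /functional big1 // => m /eqP m_t; rewrite hT ?m_t ?mul0r.
Qed.

End Truncation.

Section Certificates.
Variables (N t n : nat).
Notation B := 'X_{1..N.+1 < t.+1}.
Notation J := ('I_n * 'I_t.+1)%type.

Section Ring.
Variables (S : comNzRingType) (v : 'I_n -> 'I_N.+1 -> S) (Z : J -> B -> S).

(** The matrix sending a polynomial of degree at most t to the values at [v i] of its components of
    degree d, for all pairs [j = (i, d)]. Its kernel is J up to degree t once each [v i] is
    normalized. *)
Definition eval_coef (m : B) (j : J) : S :=
  (mdeg m == j.2)%:R * \prod_l v j.1 l ^+ m l.

(* With E = eval_coef and E Z E = E, the rows of 1 - E Z generate the kernel of E,
   and an equation w E = 0 gives w = w (1 - E Z) after any change of rings. *)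
Definition kernel_gen (m : B) : {mpoly S[N.+1]} :=
  poly_of (fun m' => (m == m')%:R - \sum_j eval_coef m j * Z j m').

Definition regular_cert : Prop :=
  forall m j, \sum_m' (\sum_j' eval_coef m j' * Z j' m') * eval_coef m' j = eval_coef m j.

Lemma meval_pihomog_poly_of (w : B -> S) (j : J) :
  (pihomog mdeg j.2 (poly_of w)).@[v j.1] = \sum_m w m * eval_coef m j.
Proof.
have -> : pihomog mdeg j.2 (poly_of w) = \sum_m w m *: pihomog mdeg j.2 'X_[val m].
  by rewrite linear_sum; apply: eq_bigr => m _; rewrite linearZ.
rewrite raddf_sum; apply: eq_bigr => m _; rewrite /= mevalZ pihomogX /eval_coef.
by case: eqP => _; rewrite ?mul1r ?mevalX // mul0r meval0.
Qed.

Lemma meval_kernel_gen m i d : regular_cert ->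
  (pihomog mdeg d (kernel_gen m)).@[v i] = 0.
Proof.
move=> cert; have [le_d|lt_d] := ltnP d t.+1.
  rewrite (meval_pihomog_poly_of _ (i, Ordinal le_d)).
  under eq_bigr do rewrite mulrBl.
  rewrite sumrB cert (bigD1 m) //= eqxx mul1r big1 ?addr0 ?subrr // => m' m'm.
  by rewrite eq_sym (negPf m'm) mul0r.
rewrite (_ : pihomog _ _ _ = 0) ?meval0 // linear_sum big1 // => m' _.
by rewrite linearZ /= pihomogX ltn_eqF ?scaler0 // (leq_trans (bmdeg m')).
Qed.

Lemma kernel_gen_span (h : {mpoly S[N.+1]}) :
  (forall i d, (pihomog mdeg d h).@[v i] = 0) ->
  order_gt t (h - \sum_(m : B) h@_m *: kernel_gen m).
Proof.
move=> hv; suff -> : \sum_(m : B) h@_m *: kernel_gen m = poly_of (fun m : B => h@_m).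
  exact: sub_poly_of.
have hE (j : J) : \sum_(m : B) h@_m * eval_coef m j = 0.
  rewrite -meval_pihomog_poly_of -[RHS](hv j.1 j.2); congr meval; apply/mpolyP => m.
  rewrite !mcoeff_pihomog; case: eqP => // m_j.
  have lt_m : (mdeg m < t.+1)%N by rewrite m_j.
  by rewrite -[m]/(val (BMultinom lt_m)) poly_ofE.
under eq_bigr do rewrite scaler_sumr.
rewrite exchange_big; apply: eq_bigr => m' _ /=.
under eq_bigr do rewrite scalerA.
rewrite -scaler_suml; congr (_ *: _).
under eq_bigr do rewrite mulrBr mulr_sumr.
rewrite sumrB exchange_big (bigD1 m') //= eqxx mulr1 big1 => [|m mm']; last first.
  by rewrite (negPf mm') mulr0.
rewrite big1 => [|j _]; first by rewrite addr0 subr0.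
under eq_bigr do rewrite mulrA.
by rewrite -mulr_suml hE mul0r.
Qed.

End Ring.

Lemma map_kernel_gen (S T : comNzRingType) (phi : {rmorphism S -> T}) v Z m :
  map_mpoly phi (kernel_gen v Z m) =
  kernel_gen (fun i l => phi (v i l)) (fun j m' => phi (Z j m')) m.
Proof.
rewrite raddf_sum; apply: eq_bigr => m' _; rewrite /= map_mpolyZ map_mpolyX; congr (_ *: _).
rewrite rmorphB rmorph_nat rmorph_sum; congr (_ - _); apply: eq_bigr => j _.
rewrite rmorphM rmorphM rmorph_nat rmorph_prod; congr (_ * _ * _).
by apply: eq_bigr => l _; rewrite rmorphXn.
Qed.

End Certificates.

(** * Transfer of a counterexample to positive characteristic *)

(** Grouping terms by the choice of generators leaves a fixed finite family of cofactors, whose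
    coefficients can then be lifted. *)
Lemma ideal_exp_finite (A : comNzRingType) (T : finType) (g : T -> A) e f :
  ideal_exp (ideal_gen (range g)) e f ->
  exists a : {ffun 'I_e -> T} -> A, f = \sum_w a w * \prod_j g (w j).
Proof.
rewrite ideal_exp_gen => -[l [a [h [Hh ->]]]].
have /choice[w Hw] : forall i, exists w : {ffun 'I_e -> T}, h i = \prod_j g (w j).
  move=> i; have [h' [Hh' ->]] := Hh i.
  have /choice[w Hw] : forall j, exists x, g x = h' j.
    by move=> j; have [x _ <-] := Hh' j; exists x.
  by exists [ffun j => w j]; apply: eq_bigr => j _; rewrite ffunE.
exists (fun u => \sum_(i < l | w i == u) a i).
rewrite (partition_big w predT) //=; apply: eq_bigr => u _.
by rewrite mulr_suml; apply: eq_bigr => i /eqP<-; rewrite Hw.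
Qed.

Lemma lift_mpoly (A S : comNzRingType) (phi : {rmorphism A -> S}) n (q : {mpoly S[n]}) :
  (forall m, m \in msupp q -> exists a, phi a = q@_m) ->
  exists q', map_mpoly phi q' = q.
Proof.
move=> lift_q; have /choice[a Ha] : forall m, exists a, phi a = q@_m.
  move=> m; have [/lift_q//|] := boolP (m \in msupp q).
  by move/memN_msupp_eq0->; exists 0; rewrite rmorph0.
exists (\sum_(m <- msupp q) a m *: 'X_[m]).
rewrite [RHS]mpolyE raddf_sum; apply: eq_bigr => m _.
by rewrite /= map_mpolyZ map_mpolyX Ha.
Qed.

Lemma point_ideals_neq0 (F : fieldType) N n (v : 'I_n -> 'I_N.+1 -> F) (c : 'I_n -> 'I_N.+1) :
  (0 < N)%N -> exists2 h : {mpoly F[N.+1]}, h != 0 &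
    (\bigcap_(i in setT) ideal_gen (range (line_gens (v i) (c i)))) h.
Proof.
move=> N_gt0; pose j0 := Ordinal N_gt0; exists (\prod_i line_gens (v i) (c i) j0).
  by apply/prodf_neq0 => i _; apply: line_gens_neq0.
move=> i _; rewrite (bigD1 i) //= mulrC.
case: (ideal_genI (range (line_gens (v i) (c i)))) => _ _; apply.
by apply: sub_ideal_gen; exists j0.
Qed.

Lemma map_functional (S T : comNzRingType) (phi : {rmorphism S -> T}) N t
    (lam : 'X_{1..N.+1 < t.+1} -> S) (h : {mpoly S[N.+1]}) :
  phi (functional lam h) = functional (fun m => phi (lam m)) (map_mpoly phi h).
Proof.
rewrite rmorph_sum; apply: eq_bigr => m _.
by rewrite rmorphM mcoeff_map_mpoly.
Qed.

Lemma closed_field_perfect (L : closedFieldType) p : (0 < p)%N ->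
  forall x : L, exists y, y ^+ p = x.
Proof.
move=> p_gt0 x; have /closed_rootP[y] : size ('X^p - x%:P) != 1%N.
  by rewrite size_XnsubC // eqSS -lt0n.
by rewrite /root !hornerE subr_eq0 => /eqP; exists y.
Qed.

(** J lies in the ideal generated by the kernel generators and [order_gt t]. A product with a factor
    in [order_gt t], or with a monomial of degree above t, is invisible to [functional lam], so
    finitely many equations control all of J^k. *)
Lemma functional_exp_eq0 (F : fieldType) N n t k (v : 'I_n -> 'I_N.+1 -> F) Z
    (c : 'I_n -> 'I_N.+1) (lam : 'X_{1..N.+1 < t.+1} -> F) (f : {mpoly F[N.+1]}) :
  (forall i, v i (c i) = 1) ->
  (forall (x : 'X_{1..N.+1 < t.+1}) (g : {ffun 'I_k -> 'X_{1..N.+1 < t.+1}}),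
     functional lam ('X_[x] * \prod_j kernel_gen v Z (g j)) = 0) ->
  ideal_exp (\bigcap_(i in setT) ideal_gen (range (line_gens (v i) (c i)))) k f ->
  functional lam f = 0.
Proof.
move=> vc lam0; set J := (X in ideal_exp X).
have [T0 TD TM] := order_gtI F N t.
pose S := [set h | forall a, functional lam (a * h) = 0].
have SI : is_ideal S.
  split=> [a|x y Sx Sy a|b x Sx a] /=.
  - by rewrite mulr0 functional_order_gt.
  - by rewrite mulrDr functionalD Sx Sy addr0.
  - by rewrite mulrA Sx.
pose G := range (kernel_gen v Z) `|` order_gt t.
have sJG : J `<=` ideal_gen G.
  move=> h Jh; have [_ GD GM] := ideal_genI G.
  have hv i d : (pihomog mdeg d h).@[v i] = 0.
    by move: d; apply/(line_idealP (vc i)); apply: Jh.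
  rewrite -[h](subrK (\sum_(m : 'X_{1..N.+1 < t.+1}) h@_m *: kernel_gen v Z m)).
  apply: GD; first by apply: sub_ideal_gen; right; apply: kernel_gen_span.
  apply: (ideal_sum _ (ideal_genI _)) => m _.
  by rewrite -mul_mpolyC; apply/GM/sub_ideal_gen; left; exists m.
move=> /(ideal_exp_sub sJG); rewrite ideal_exp_gen => fG.
suff : S f by move/(_ 1); rewrite mul1r.
apply: (ideal_gen_min SI) fG => _ [g [Gg ->]].
have [[j Tj]|noT] := pselect (exists j, order_gt t (g j)).
  by move=> a; apply: functional_order_gt; rewrite (bigD1 j) //= mulrCA mulrC; apply: TM.
have /choice[w Hw] : forall j, exists m, kernel_gen v Z m = g j.
  move=> j; case: (Gg j) => [[m _ <-]|Tj]; first by exists m.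
  by case: noT; exists j.
have {Hw} -> : \prod_j g j = \prod_j kernel_gen v Z ([ffun j => w j] j).
  by apply: eq_bigr => j _; rewrite ffunE.
elim/mpolyind => [|x m a _ _ IHa]; first by rewrite mul0r functional_order_gt.
rewrite mulrDl functionalD IHa addr0 -scalerAl functionalZ.
have [lt_m|le_m] := ltnP (mdeg m) t.+1.
  by rewrite (lam0 (BMultinom lt_m)) mulr0.
rewrite functional_order_gt ?mulr0 // mulrC; apply: TM => m' le_m'.
by rewrite mcoeffX; case: eqP => // E; move: le_m' le_m; rewrite E leqNgt => /negbTE->.
Qed.

(* If f is not in J^k, a functional separates f from J^k.  Together with equations
   witnessing that the kernel generators span J up to degree t and that f lies in
   every P_i^(N k), it lives over a finitely generated subring of K, and is
   transported to an algebraically closed field of positive characteristic. *)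
Lemma field_containment (K : fieldType) N n t k (v : 'I_n -> 'I_N.+1 -> K)
    (c : 'I_n -> 'I_N.+1) (f : {mpoly K[N.+1]}) :
  (0 < N)%N -> (0 < k)%N -> (forall i, v i (c i) = 1) -> f \is t.-homog ->
  (forall i, ideal_exp (ideal_gen (range (line_gens (v i) (c i)))) (N * k) f) ->
  ideal_exp (\bigcap_(i in setT) ideal_gen (range (line_gens (v i) (c i)))) k f.
Proof.
move=> N_gt0 k_gt0 vc f_t fP; set J := \bigcap_(i in _) _.
pose B : finType := 'X_{1..N.+1 < t.+1}; pose I : finType := ('I_n * 'I_t.+1)%type.
have JI : is_ideal J by apply: bigcap_ideal => i; apply: ideal_genI.
have Jhom : homog_closed J.
  by move=> d h Jh i _; apply: line_ideal_homog => //; apply: Jh.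
have [Z certZ] := regular_inverse (eval_coef v : B -> I -> K).
have JG m : J (kernel_gen v Z m).
  by move=> i _; apply/(line_idealP (vc i)) => d; apply: meval_kernel_gen.
(* These rows lie in J^k, so the claim holds if [f] is a combination of them. Otherwise the
   separating functional satisfies exactly the equations that [functional_exp_eq0] requires over
   [L]. *)
pose W (l : B * {ffun 'I_k -> B}) (m : B) : K :=
  (pihomog mdeg t ('X_[l.1] * \prod_j kernel_gen v Z (l.2 j)))@_m.
have [[a Ea]|[lam lamW lamf]] := separating_functional W (fun m : B => f@_m).
  have -> : f = \sum_l a l *: pihomog mdeg t ('X_[l.1] * \prod_j kernel_gen v Z (l.2 j)).
    apply/mpolyP => m; rewrite raddf_sum /=.
    have [lt_m|le_m] := ltnP (mdeg m) t.+1.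
      by rewrite -[m]/(val (BMultinom lt_m)) Ea; apply: eq_bigr => l _; rewrite mcoeffZ.
    rewrite (dhomog_nemf_coeff f_t) ?gtn_eqF // big1 // => l _.
    by rewrite mcoeffZ mcoeff_pihomog gtn_eqF ?mulr0.
  have [_ _ JM] := ideal_expI J k; apply: (ideal_sum _ (ideal_expI J k)) => l _.
  rewrite -mul_mpolyC; apply/JM/ideal_exp_homog => //; apply/JM.
  by apply: ideal_exp_prod.
have /choice[q Hq] : forall i, exists q, f = _ := fun i => ideal_exp_finite (fP i).
pose polys (x : option ('I_n * {ffun 'I_(N * k) -> 'I_N})) :=
  if x is Some (i, w) then q i w else f.
pose s := codom (fun x : 'I_n * 'I_N.+1 => v x.1 x.2) ++
  codom (fun x : I * B => Z x.1 x.2) ++ codom lam ++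
  flatten (codom (fun x => [seq (polys x)@_m | m <- msupp (polys x)])).
have [A [iota [L [phi [p [pL lift_s ker_phi]]]]]] := specialize s.
have /choice[v' Hv] : forall x : 'I_n * 'I_N.+1, exists y, iota y = v x.1 x.2.
  by move=> x; apply: lift_s; rewrite mem_cat codom_f.
have /choice[Z' HZ] : forall x : I * B, exists y, iota y = Z x.1 x.2.
  by move=> x; apply: lift_s; rewrite !mem_cat codom_f orbT.
have /choice[lam' Hlam] : forall m, exists y, iota y = lam m.
  by move=> m; apply: lift_s; rewrite !mem_cat codom_f !orbT.
have /choice[polys' Hpolys] : forall x, exists y, map_mpoly iota y = polys x.
  move=> x; apply: lift_mpoly => m m_x; apply: lift_s; rewrite !mem_cat.
  apply/orP; right; apply/orP; right; apply/orP; right; apply/flattenP.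
  by eexists; [exact: (codom_f _ x) | apply: map_f].
have Ev : (fun i l => iota (v' (i, l))) = v by apply/funext => i; apply/funext => l; apply: Hv.
have EZ : (fun j m => iota (Z' (j, m))) = Z by apply/funext => j; apply/funext => m; apply: HZ.
have Elam : (fun m => iota (lam' m)) = lam by apply/funext.
(* [iota] need not be injective, so an identity over [K] may fail over [A]; it is carried over as a
   difference killed by [iota], hence by [phi]. *)
have ker_map (h : {mpoly A[N.+1]}) : map_mpoly iota h = 0 -> map_mpoly phi h = 0.
  move=> h0; apply/mpolyP => m; rewrite mcoeff_map_mpoly mcoeff0; apply: ker_phi.
  by rewrite -mcoeff_map_mpoly h0 mcoeff0.
pose vL i l := phi (v' (i, l)); pose ZL j m := phi (Z' (j, m)).
pose lamL m := phi (lam' m); pose fL := map_mpoly phi (polys' None).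
have vcL i : vL i (c i) = 1.
  apply/eqP; rewrite -subr_eq0 -(rmorph1 phi) -rmorphB; apply/eqP/ker_phi.
  by rewrite rmorphB rmorph1 Hv vc subrr.
have fPL i : ideal_exp (ideal_gen (range (line_gens (vL i) (c i)))) (N * k) fL.
  pose E := polys' None - \sum_w polys' (Some (i, w)) *
    \prod_j line_gens (fun l => v' (i, l)) (c i) (w j).
  have mapE (T : comNzRingType) (psi : {rmorphism A -> T}) : map_mpoly psi E =
      map_mpoly psi (polys' None) - \sum_w map_mpoly psi (polys' (Some (i, w))) *
        \prod_j line_gens (fun l => psi (v' (i, l))) (c i) (w j).
    rewrite rmorphB rmorph_sum; congr (_ - _); apply: eq_bigr => w _.
    rewrite rmorphM rmorph_prod; congr (_ * _); apply: eq_bigr => j _.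
    exact: map_line_gens.
  have : map_mpoly phi E = 0.
    apply: ker_map; rewrite mapE Hpolys /= {1}(Hq i); apply/eqP; rewrite subr_eq0.
    apply/eqP/eq_bigr => w _; rewrite Hpolys /=; congr (_ * _).
    by apply: eq_bigr => j _; rewrite -Ev.
  rewrite mapE => /eqP; rewrite subr_eq0 => /eqP; rewrite -/fL => ->.
  have [_ _ PM] := ideal_expI (ideal_gen (range (line_gens (vL i) (c i)))) (N * k).
  apply: (ideal_sum _ (ideal_expI _ _)) => w _; apply/PM/ideal_exp_prod => j.
  by apply: sub_ideal_gen; exists (w j).
have lamL0 (x : B) (g : {ffun 'I_k -> B}) :
    functional lamL ('X_[x] * \prod_j kernel_gen vL ZL (g j)) = 0.
  pose E := 'X_[x] *
    \prod_j kernel_gen (fun i l => v' (i, l)) (fun j m => Z' (j, m)) (g j).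
  have mapE (T : comNzRingType) (psi : {rmorphism A -> T}) : map_mpoly psi E =
      'X_[x] * \prod_j kernel_gen (fun i l => psi (v' (i, l)))
        (fun j m => psi (Z' (j, m))) (g j).
    rewrite rmorphM rmorph_prod /= map_mpolyX; congr (_ * _); apply: eq_bigr => j _.
    exact: map_kernel_gen.
  rewrite -(mapE L phi) -map_functional; apply: ker_phi.
  rewrite map_functional mapE Elam Ev EZ -[RHS](lamW (x, g)) /functional big_mkcond.
  by apply: eq_bigr => m _; rewrite /W mcoeff_pihomog; case: ifP; rewrite ?mul0r.
have lamfL : functional lamL fL = 1.
  rewrite -map_functional -(rmorph1 phi); apply/eqP; rewrite -subr_eq0 -rmorphB.
  apply/eqP/ker_phi; rewrite rmorphB rmorph1 map_functional Elam Hpolys -lamf.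
  apply/eqP; rewrite subr_eq0 /functional big_mkcond; apply/eqP/eq_bigr => m _ /=.
  by case: ifPn => // m_t; rewrite (dhomog_nemf_coeff f_t) ?mul0r.
have [h h_neq0 Jh] := point_ideals_neq0 vL c N_gt0.
have perfL := @closed_field_perfect L p (prime_gt0 (pcharf_prime pL)).
have := perfect_containment pL perfL N_gt0 k_gt0 h_neq0 Jh fPL.
move=> /(functional_exp_eq0 vcL lamL0); rewrite lamfL => /eqP.
by rewrite oner_eq0.
Qed.

(** * Return to projective points, and the degree count *)

Section Points.
Variables (K : fieldType) (N : nat).
Notation R := {mpoly K[N.+1]}.

Lemma point_ideal_lineE (q : proj_point K N) :
  exists (v : 'I_N.+1 -> K) (c : 'I_N.+1),
    v c = 1 /\ point_ideal q = ideal_gen (range (line_gens v c)).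
Proof.
case: q => U dimU; set q := ProjPoint dimU.
have /rV0Pn[c uc_neq0] : vpick U != 0 by rewrite vpick0 -dimv_eq0 (eqP dimU).
pose w := (vpick U 0 c)^-1 *: vpick U; exists (w 0), c.
have wc1 : w 0 c = 1 by rewrite mxE mulVf.
have w_U : w \in U by rewrite memvZ ?memv_pick.
have UE : U = <[w]>%VS.
  apply/eqP; rewrite eq_sym eqEdim -memvE w_U (eqP dimU) dim_vline.
  by case: eqP wc1 => // ->; rewrite mxE => /eqP; rewrite eq_sym oner_eq0.
split=> //; apply/seteqP; split; apply: (ideal_gen_min (ideal_genI _)).
  move=> f [[d f_d] f_q]; apply/(line_ideal_homogP wc1 f_d); exact: f_q.
move=> _ [j _ <-]; apply: sub_ideal_gen; split; first by exists 1%N; apply: line_gens_homog.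
move=> x; rewrite /= UE => /vlineP[a ->].
by rewrite mevalB mevalM mevalC !mevalXU ![(a *: w) _ _]mxE wc1 mulr1 mulrC subrr.
Qed.

Lemma point_ideal_homog (q : proj_point K N) : homog_closed (point_ideal q).
Proof. by apply: ideal_gen_homog => g []. Qed.

Lemma symbolic_power_homog n (p : 'I_n -> proj_point K N) e :
  homog_closed (symbolic_power p e).
Proof.
move=> d f fS i _; apply: ideal_exp_homog; last exact: fS.
  exact: ideal_genI.
exact: point_ideal_homog.
Qed.

Lemma points_ideal_exp_sub n (p : 'I_n -> proj_point K N) e :
  ideal_exp (points_ideal p) e `<=` symbolic_power p e.
Proof. by move=> f fJ i _; apply: ideal_exp_sub fJ => g; apply. Qed.

Lemma symbolic_power_containment n (p : 'I_n -> proj_point K N) k d (f : R) :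
  (0 < N)%N -> (0 < k)%N -> f \is d.-homog ->
  symbolic_power p (N * k) f -> ideal_exp (points_ideal p) k f.
Proof.
move=> N_gt0 k_gt0 f_d fS.
have /choice[v /choice[c vc]] : forall i, exists (v : 'I_N.+1 -> K) (c : 'I_N.+1),
    v c = 1 /\ point_ideal (p i) = ideal_gen (range (line_gens v c)).
  by move=> i; apply: point_ideal_lineE.
have -> : points_ideal p = \bigcap_(i in setT) ideal_gen (range (line_gens (v i) (c i))).
  by apply: eq_bigcapr => i _; case: (vc i).
apply: (field_containment N_gt0 k_gt0 _ f_d) => i; first by case: (vc i).
by case: (vc i) => _ <-; apply: fS.
Qed.

(** A least degree exists by well-ordering, so [xget] does not return its default value. *)
Lemma alpha_le (J : set R) l : nonzero_component J l -> (alpha J <= l)%N.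
Proof.
move=> Jl; pose Q := [pred l | `[< nonzero_component J l >]].
have exQ : exists l, Q l by exists l; apply/asboolP.
case: (ex_minnP exQ) => l0 /asboolP Jl0 min_l0; rewrite /alpha.
have /(xgetPex 0%N)[_ ->//] : exists l, nonzero_component J l /\
    forall l', nonzero_component J l' -> (l <= l')%N.
  by exists l0; split=> // l' Jl'; apply/min_l0/asboolP.
Qed.

Lemma irrelevant_exp d e (f : R) : f \is d.-homog -> (e <= d)%N ->
  ideal_exp (irrelevant_ideal K N) e f.
Proof.
move=> f_d le_ed; have [_ _ MM] := ideal_expI (irrelevant_ideal K N) e.
rewrite [f]mpolyE big_seq; apply: (ideal_sum _ (ideal_expI _ _)) => m m_f.
rewrite -mul_mpolyC; apply: MM.
have {f_d m_f} : (e <= mdeg m)%N by rewrite (dhomog_mf f_d m_f).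
elim: e m {le_ed} => [//|e IHe] m lt_em.
have [i mi] : exists i, m i != 0%N.
  apply/not_existsP => m0; move: lt_em; rewrite mdegE big1 // => i _.
  by apply/eqP/negPn/negP/m0.
have le_im : (U_(i) <= m)%MM by rewrite lep1mP.
rewrite -(submK le_im) mpolyXD mulrC ideal_expS; apply: ideal_mul_mem.
  by apply: sub_ideal_gen; exists i.
by apply: IHe; move: lt_em; rewrite -{1}(submK le_im) mdegD mdeg1 addn1.
Qed.

End Points.

Theorem proposition2p3 (K : fieldType) (N n : nat) (p : 'I_n -> proj_point K N)
    (m r : nat) (s : int)
    (hN : (0 < N)%N) (hp : injective p) (hm : (0 < m)%N) (hr : (0 < r)%N)
    (hgen : generated_in_degree_le (points_ideal p) s)
    (halpha : r%:Z * m%:Z * s + r%:Z * m%:Z * (N%:Z - 1)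
                <= (alpha (symbolic_power p (m * (N * r))))%:Z) :
  symbolic_power p (m * (N * r)) `<=`
    ideal_mul (ideal_exp (irrelevant_ideal K N) (r * (N - 1)))
              (ideal_exp (symbolic_power p m) r).
Proof.
move=> f fS; set I := ideal_mul _ _; have II : is_ideal I by apply: ideal_genI.
suff form_I d g : g \is d.-homog -> symbolic_power p (m * (N * r)) g -> I g.
  rewrite (pihomog_sum_le f); apply: (ideal_sum _ II) => d _.
  exact: form_I (pihomogP _ _ _) (symbolic_power_homog d fS).
move: g => {fS}f f_d fS.
have [->|f_neq0] := eqVneq f 0; first by case: II.
have le_d : (alpha (symbolic_power p (m * (N * r))) <= d)%N.
  by apply: alpha_le; exists f.
have [G [G_s EJ]] := hgen.
have fJ : ideal_exp (points_ideal p) (m * r) f.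
  by apply: (symbolic_power_containment hN _ f_d); rewrite ?muln_gt0 ?hm // mulnCA.
(* J^(mr) lies in (J^m)^r, and J^m lies in the symbolic power I. *)
have prod_sub (g : 'I_(m * r) -> {mpoly K[N.+1]}) : (forall i, G (g i)) ->
    ideal_exp (symbolic_power p m) r (\prod_i g i).
  move=> Gg; apply: (ideal_exp_sub (@points_ideal_exp_sub _ _ _ p m)).
  apply: ideal_exp_exp; first by rewrite EJ; apply: ideal_genI.
  by apply: ideal_exp_prod => i; rewrite EJ; apply: sub_ideal_gen.
move: fJ; rewrite EJ ideal_exp_gen => -[l [a [h [Hh Ef]]]].
(* Taking components of degree d makes each cofactor a form of degree d minus that of its product of
   generators, or kills the term. *)
rewrite -(pihomog_dE f_d) Ef linear_sum; apply: (ideal_sum _ II) => i _ /=.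
have [g [Gg ->]] := Hh i.
have /choice[e He] : forall j, exists e : nat, is_form e (g j) /\ e%:Z <= s.
  by move=> j; apply: G_s.
rewrite (pihomogM _ _ (homog_prod_ord (fun j => (He j).1))).
case: leqP => [le_ed|_]; last by case: II.
apply: ideal_mul_mem; last exact: prod_sub.
apply: irrelevant_exp (pihomogP _ _ _) _.
have : (\sum_j e j)%:Z <= (m * r)%:Z * s.
  rewrite -natz natr_sum (le_trans (ler_sum _ (fun j _ => _ : _ <= s))) //.
    by move=> j; rewrite natz; case: (He j).
  by rewrite sumr_const card_ord -mulr_natl natz.
(* Since d is at least r m s + r m (N - 1) and E is at most m r s, the cofactor has degree at least
   r m (N - 1), hence at least r (N - 1). *)
move: (\sum_j e j)%N le_ed => E le_ed leE; nia.
Qed.
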